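(* For every integer $n \geq 1$, $\psi_{2}(2,n) = \chi(n)$, where $\psi_2(2,n)$ is the number of primitive two-dimensional words of dimension $2\times n$ over the binary alphabet $\{0,1\}$ and $\chi(n)=|\mathcal{T}_n|$ is the number of (similarity classes of) triangles having exact pedal period $n$.
   Context: A two-dimensional word of dimension $m\times n$ over an alphabet $\Sigma$ is a map $W:\{0,\dots,m-1\}\times\{0,\dots,n-1\}\to\Sigma$. For $W$ of dimension $m\times n$ and integers $p,q\ge1$, the power $W^{p\times q}$ is the word of dimension $pm\times qn$ with $W^{p\times q}[i,j]=W[i \bmod m, j\bmod n]$. A two-dimensional word is periodic if it equals $V^{p\times q}$ for some nonempty two-dimensional word $V$ with $p\ge2$ or $q\ge2$; otherwise it is primitive. $\psi_2(m,n)$ denotes the number of primitive two-dimensional words of dimension $m\times n$ over $\{0,1\}$. Triangles are represented up to similarity by sorted normalized angle triples: $\overline{C}=\{(a,b,c)\in\mathbb{R}^3 : a\ge b\ge c\ge 0,\ a+b+c=1\}$, $C=\{(a,b,c)\in\mathbb{R}^3: a\ge b\ge c>0,\ a+b+c=1\}$ (angles $a\pi,b\pi,c\pi$), and $C^*=\{(a,b,c)\in C: a\neq 1/2\}$. Partition $C^*$ into $R_0=\{a<1/2\}$, $R_1=\{2a-1\ge 2b,\ a>1/2\}$, $R_2=\{2b>2a-1\ge 2c,\ a>1/2\}$, $R_3=\{2c>2a-1,\ a>1/2\}$ (all within $C^*$). The sorted pedal map $P:C^*\to C$ is $P(a,b,c)=(1-2c,1-2b,1-2a)$ on $R_0$,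 $(2a-1,2b,2c)$ on $R_1$, $(2b,2a-1,2c)$ on $R_2$, $(2b,2c,2a-1)$ on $R_3$ (this is the angle map sending a triangle to its pedal/orthic triangle, followed by sorting). For $n\ge1$, $\mathcal{T}_n=\{p\in C : P^j(p)\text{ is defined for all }0\le j<n,\ P^n(p)=p,\ P^d(p)\ne p \text{ for all }1\le d<n\}$, the set of triangles of exact pedal period $n$, and $\chi(n)=|\mathcal{T}_n|$. *)

(* Defs.v *)
From HB Require Import structures.
From mathcomp Require Import all_boot all_order all_algebra.
From mathcomp Require Import boolp reals.
Set Implicit Arguments. Unset Strict Implicit. Unset Printing Implicit Defensive.
Import Order.TTheory GRing.Theory Num.Theory.

Definition word2 (m n : nat) := {ffun 'I_m * 'I_n -> bool}.

Definition ord_mod (k i : nat) : 'I_k.+1 := Ordinal (ltn_pmod i (ltn0Sn k)).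

(* W is periodic iff W = V^{p x q} for some nonempty V and p >= 2 or q >= 2.
   The equality of dimensions p*m'.+1 = m, q*n'.+1 = n is stated explicitly,
   and the entries are compared pointwise. *)
Definition periodic (m n : nat) (W : word2 m n) : Prop :=
  exists (m' n' p q : nat) (V : word2 m'.+1 n'.+1),
    [/\ p * m'.+1 = m, q * n'.+1 = n, (2 <= p) || (2 <= q) &
      forall (i : 'I_m) (j : 'I_n),
        W (i, j) = V (ord_mod m' i, ord_mod n' j)].

Definition primitive (m n : nat) (W : word2 m n) : Prop := ~ periodic W.

Definition psi2 (m n : nat) : nat :=
  #|[set W : word2 m n | `[< primitive W >] ]|.

Local Open Scope ring_scope.

Section Pedal.
Variable R : realType.

Definition inC (t : R * R * R) : Prop :=
  let: (a, b, c) := t in [/\ b <= a, c <= b, 0 < c & a + b + c = 1].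

Definition inCstar (t : R * R * R) : Prop :=
  let: (a, b, c) := t in inC t /\ a != 1 / 2.

(* Sorted pedal map; its values matter only on C^*, where the four branches
   are exactly R_0, R_1, R_2, R_3. *)
Definition pedal (t : R * R * R) : R * R * R :=
  let: (a, b, c) := t in
  if a < 1 / 2 then (1 - 2 * c, 1 - 2 * b, 1 - 2 * a)
  else if 2 * b <= 2 * a - 1 then (2 * a - 1, 2 * b, 2 * c)
  else if 2 * c <= 2 * a - 1 then (2 * b, 2 * a - 1, 2 * c)
  else (2 * b, 2 * c, 2 * a - 1).

(* p in T_n: exact pedal period n (P^j(p) in C^* for j < n, so that P^n(p)
   is defined). *)
Definition inT (n : nat) (t : R * R * R) : Prop :=
  [/\ inC t,
      (forall j, (j < n)%N -> inCstar (iter j pedal t)),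
      iter n pedal t = t &
      forall d, (1 <= d)%N -> (d < n)%N -> iter d pedal t <> t].

End Pedal.

(* Main.v *)
Require Import Defs.
From HB Require Import structures.
From mathcomp Require Import all_boot all_order all_algebra.
From mathcomp Require Import boolp reals.
From mathcomp Require Import ring lra zify.

(** Each of the four branches of [pedal] is an affine bijection from a closed
    piece of the closed triangle [inCbar] onto the whole of it, with linear part
    2 times a signed coordinate permutation.  Hence the inverse branches
    contract by 1/2, and a cyclic word of length [n] over the four branches has
    exactly one fixed point in the closed triangle.  Encode the branches by the
    columns of a 2 x n binary word, the branches R_1 and R_2 that double the
    smallest angle being the columns with equal entries.  A word using only
    these two branches has its fixed point on the boundary, and every other word
    has its whole orbit in C^*: the only boundary orbits that ever leave the
    branches R_1, R_2 fall onto the degenerate triangle (1, 0, 0) and stay there.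
    Such an orbit also avoids the lines separating the branches, because a point
    of these lines has an isosceles image; isosceles triangles form an invariant
    set, and the only isosceles point of these lines is mapped to the equilateral
    fixed point.  So cyclic words and periodic points correspond bijectively,
    and exact periods correspond to primitivity. *)

Set Implicit Arguments. Unset Strict Implicit. Unset Printing Implicit Defensive.
Import Order.TTheory GRing.Theory Num.Theory.
Local Open Scope ring_scope.

(** * Periods of iterated maps *)

Lemma iter_mul_fixed (T : Type) (f : T -> T) (d k : nat) (x : T) :
  iter d f x = x -> iter (k * d) f x = x.
Proof. by move=> fx; rewrite iterM; elim: k => //= k ->. Qed.

Lemma iter_modn (T : Type) (f : T -> T) (d j : nat) (x : T) :
  iter d f x = x -> iter (j %% d)%N f x = iter j f x.
Proof.
by move=> fx; rewrite [in RHS](divn_eq j d) addnC iterD iter_mul_fixed.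
Qed.

Lemma iter_gcdn_fixed (T : Type) (f : T -> T) (d n : nat) (x : T) :
  (0 < d)%N -> iter d f x = x -> iter n f x = x -> iter (gcdn d n) f x = x.
Proof.
move=> d_gt0 fd fn; case: (egcdnP n d_gt0) => km kn e _.
by rewrite -{2}(iter_mul_fixed km fd) e addnC iterD (iter_mul_fixed kn fn).
Qed.

(** * Coordinate permutations and similarities of [R * R * R] *)

Inductive perm3 := Pid | P102 | P021 | P210 | P201 | P120.

Definition act3 (T : Type) (k : perm3) (u : T * T * T) : T * T * T :=
  let: (x, y, z) := u in
  match k with
  | Pid => (x, y, z) | P102 => (y, x, z) | P021 => (x, z, y)
  | P210 => (z, y, x) | P201 => (z, x, y) | P120 => (y, z, x)
  end.

Lemma act3_comp (k l : perm3) :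
  exists m, forall (T : Type) (u : T * T * T), act3 m u = act3 k (act3 l u).
Proof.
by case: k; case: l; first [by exists Pid => T [[x y] z]
  | by exists P102 => T [[x y] z] | by exists P021 => T [[x y] z]
  | by exists P210 => T [[x y] z] | by exists P201 => T [[x y] z]
  | by exists P120 => T [[x y] z]].
Qed.

(* The symmetric group on three letters has exponent 6. *)
Lemma act3_iter6 (T : Type) (k : perm3) (u : T * T * T) :
  iter 6 (act3 k) u = u.
Proof. by case: u => -[x y] z; case: k. Qed.

Section Similarity.
Variable R : realType.
Implicit Types (u v t : R * R * R) (c d : R) (f : R * R * R -> R * R * R).

Definition sub3 u v := (u.1.1 - v.1.1, u.1.2 - v.1.2, u.2 - v.2).
Definition scale3 c u := (c * u.1.1, c * u.1.2, c * u.2).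

Lemma act3_scale k c u : act3 k (scale3 c u) = scale3 c (act3 k u).
Proof. by case: u => -[x y] z; case: k. Qed.

Lemma scale3A c d u : scale3 c (scale3 d u) = scale3 (c * d) u.
Proof. by rewrite /scale3 /= !mulrA. Qed.

(** The ratio [c] carries the sign of the linear part, so it may be negative. *)
Definition similarity c f :=
  exists k, forall u v, sub3 (f u) (f v) = scale3 c (act3 k (sub3 u v)).

Lemma similarity_id : similarity 1 id.
Proof. by exists Pid => u v; rewrite /sub3 /scale3 /= !mul1r. Qed.

Lemma similarity_comp c d f g :
  similarity c f -> similarity d g -> similarity (c * d) (f \o g).
Proof.
move=> [k fk] [l gl]; have [m mE] := act3_comp k l; exists m => u v.
by rewrite mE -scale3A -act3_scale -gl -fk.
Qed.

Lemma similarity_iter6 c f u v :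
  similarity c f -> sub3 (iter 6 f u) (iter 6 f v) = scale3 (c ^+ 6) (sub3 u v).
Proof.
move=> [k fk].
suff E j : sub3 (iter j f u) (iter j f v)
           = scale3 (c ^+ j) (iter j (act3 k) (sub3 u v)).
  by rewrite E act3_iter6.
elim: j => [|j IH]; first by rewrite /scale3 /= !mul1r.
by rewrite !iterS fk IH act3_scale scale3A exprS.
Qed.

(* The sixth iterate of a similarity of ratio c is the homothety
   u |-> c ^ 6 u + f^6(0), whose fixed point is explicit. *)
Definition fixpt c f : R * R * R :=
  scale3 (1 - c ^+ 6)^-1 (iter 6 f (0, 0, 0)).

Lemma similarity_iter6E c f u :
  similarity c f ->
  [/\ (iter 6 f u).1.1 = c ^+ 6 * u.1.1 + (iter 6 f (0, 0, 0)).1.1,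
      (iter 6 f u).1.2 = c ^+ 6 * u.1.2 + (iter 6 f (0, 0, 0)).1.2 &
      (iter 6 f u).2 = c ^+ 6 * u.2 + (iter 6 f (0, 0, 0)).2].
Proof.
move=> /(similarity_iter6 u (0, 0, 0)); move: (iter 6 f u) (iter 6 f _).
by move=> p q [] /= ? ? ?; split; lra.
Qed.

Lemma iter6_fixed_uniq c f u :
  similarity c f -> c ^+ 6 < 1 -> iter 6 f u = u -> u = fixpt c f.
Proof.
move=> sf c1 fu; have n0 : 1 - c ^+ 6 != 0 by rewrite subr_eq0 gt_eqF.
have := similarity_iter6E u sf; rewrite fu /fixpt /scale3.
move: (iter 6 f _) => q {fu} [e1 e2 e3].
by case: u e1 e2 e3 => -[x y] z /= e1 e2 e3; congr (_, _, _);
  apply: (mulfI n0); rewrite mulVKf //; lra.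
Qed.

Lemma fixed_uniq c f u :
  similarity c f -> c ^+ 6 < 1 -> f u = u -> u = fixpt c f.
Proof.
by move=> sf c1 fu; apply: iter6_fixed_uniq => //; rewrite /= !fu.
Qed.

Lemma iter6_fixpt c f :
  similarity c f -> c ^+ 6 < 1 -> iter 6 f (fixpt c f) = fixpt c f.
Proof.
move=> sf c1; have n0 : 1 - c ^+ 6 != 0 by rewrite subr_eq0 gt_eqF.
have := similarity_iter6E (fixpt c f) sf.
rewrite {2 4 6}/fixpt /scale3; case: (iter 6 f (fixpt c f)) => -[x y] z /=.
rewrite /fixpt /scale3 /=.
move: (f (f _)) => q [-> -> ->]; congr (_, _, _); field; exact: n0.
Qed.

(** [f] commutes with its sixth iterate, hence preserves the unique fixed point of that iterate. *)
Lemma fixptP c f : similarity c f -> c ^+ 6 < 1 -> f (fixpt c f) = fixpt c f.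
Proof.
move=> sf c1; apply: iter6_fixed_uniq => //.
by rewrite -iterSr iterS iter6_fixpt.
Qed.

Definition inCbar t : Prop :=
  let: (a, b, c) := t in [/\ b <= a, c <= b, 0 <= c & a + b + c = 1].

(* Each inequality defining the closed triangle is an equality at one of the
   points (1/3, 1/3, 1/3) and (1, 0, 0), whose images lie in the triangle; this
   avoids passing to the limit along an orbit. *)
Lemma fixpt_inCbar c f :
  similarity c f -> c ^+ 6 < 1 -> (forall t, inCbar t -> inCbar (f t)) ->
  inCbar (fixpt c f).
Proof.
move=> sf c1 fC; have C6 t : inCbar t -> inCbar (iter 6 f t).
  by move=> Ct; do 6!apply: (fC _).
have := similarity_iter6E (fixpt c f) sf; rewrite iter6_fixpt //.
have /C6 : inCbar (1 / 3, 1 / 3, 1 / 3) by split; lra.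
have /C6 : inCbar (1, 0, 0) by split; lra.
have := similarity_iter6E (1, 0, 0) sf.
have := similarity_iter6E (1 / 3, 1 / 3, 1 / 3) sf.
move: (c ^+ 6) c1 (iter 6 f (0, 0, 0)) (fixpt c f) => m m1 [[q1 q2] q3] [[x y] z].
move: (iter 6 f _) (iter 6 f _) => [[? ?] ?] [[? ?] ?] [/= -> -> ->] [/= -> -> ->].
move=> [? ? ? ?] [? ? ? ?] [e1 e2 e3].
have n0 : 0 < 1 - m by lra.
split; last by apply: (mulfI (lt0r_neq0 n0)); lra.
- by rewrite -subr_ge0 -(pmulr_rge0 _ n0); lra.
- by rewrite -subr_ge0 -(pmulr_rge0 _ n0); lra.
by rewrite -(pmulr_rge0 _ n0); lra.
Qed.

End Similarity.

(** * Branches of the pedal map *)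

Definition letter : Type := (bool * bool)%type.

Section Branches.
Variable R : realType.
Implicit Types (t u v : R * R * R) (l : letter) (w : nat -> letter).

(* Code of the regions: R_0 = (0,1), R_1 = (0,0), R_2 = (1,1), R_3 = (1,0). *)
Definition region t : letter :=
  let: (a, b, c) := t in
  if a < 1 / 2 then (false, true)
  else if 2 * b <= 2 * a - 1 then (false, false)
  else if 2 * c <= 2 * a - 1 then (true, true)
  else (true, false).

Definition inv_branch l t : R * R * R :=
  let: (x, y, z) := t in
  match l with
  | (false, true) => ((1 - z) / 2, (1 - y) / 2, (1 - x) / 2)
  | (false, false) => ((1 + x) / 2, y / 2, z / 2)
  | (true, true) => ((1 + y) / 2, x / 2, z / 2)
  | (true, false) => ((1 + z) / 2, x / 2, y / 2)
  end.

Definition ratio l : R := if l is (false, true) then - (1 / 2) else 1 / 2.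

Lemma inv_branch_similarity l : similarity (ratio l) (inv_branch l).
Proof.
case: l => -[] []; [exists P102|exists P201|exists P210|exists Pid];
  by move=> [[x y] z] [[x' y'] z']; rewrite /sub3 /scale3 /=;
     congr (_, _, _); field.
Qed.

Lemma region_pedalK t : inv_branch (region t) (pedal t) = t.
Proof.
case: t => -[a b] c; rewrite /region /pedal.
by do !case: ifP => _ /=; congr (_, _, _); field.
Qed.

(** [0 < z] keeps the R_0 preimage off the line a = 1/2; the strict inequalities exclude ties, which
    [region] resolves in favour of an earlier branch. *)
Lemma region_inv_branch l (x y z : R) :
  inCbar (x, y, z) -> 0 < z ->
  (l.1 -> if l.2 then y < x else z < y) -> region (inv_branch l (x, y, z)) = l.
Proof.
move=> [? ? ? ?] ?; rewrite /region; case: l => -[] [] /= gen;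
  try (have {}gen := gen isT);
  do 3?[case: leP => ? //]; exfalso; lra.
Qed.

Lemma inv_branchK l t : region (inv_branch l t) = l -> pedal (inv_branch l t) = t.
Proof.
move=> rE; have := region_pedalK (inv_branch l t); rewrite rE.
case: t {rE} => -[x y] z; case: (pedal _) => -[x' y'] z'.
by case: l => -[] [] /= [? ? ?]; congr (_, _, _); lra.
Qed.

Lemma inv_branch_inCbar l t : inCbar t -> inCbar (inv_branch l t).
Proof.
by case: t => -[x y] z [? ? ? ?]; case: l => -[] []; split; lra.
Qed.

Definition shift w : nat -> letter := fun j => w j.+1.

Fixpoint inv_word (n : nat) w t : R * R * R :=
  if n is n'.+1 then inv_branch (w 0%N) (inv_word n' (shift w) t) else t.

Fixpoint ratio_word (n : nat) w : R :=
  if n is n'.+1 then ratio (w 0%N) * ratio_word n' (shift w) else 1.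

Lemma inv_word_similarity n w : similarity (ratio_word n w) (inv_word n w).
Proof.
elim: n w => [|n IH] w; first exact: similarity_id.
exact: similarity_comp (inv_branch_similarity (w 0%N)) (IH _).
Qed.

Lemma ratio_word_lt1 n w : (0 < n)%N -> ratio_word n w ^+ 6 < 1.
Proof.
move=> n_gt0.
(* The even power erases the signs: each letter contributes (1/2)^6. *)
have -> : ratio_word n w ^+ 6 = (1 / 64) ^+ n.
  elim: n w {n_gt0} => [|n IH] w; first by rewrite expr1n.
  rewrite /= exprMn IH [RHS]exprS; congr (_ * _).
  by case: (w 0%N) => -[] [] /=; field.
by rewrite exprn_ilt1 ?lt0n_neq0 //; lra.
Qed.

Lemma inv_word_inCbar n w t : inCbar t -> inCbar (inv_word n w t).
Proof.
by elim: n w => //= n IH w Ct; apply: inv_branch_inCbar; apply: IH.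
Qed.

Lemma inv_wordSr n w t :
  inv_word n.+1 w t = inv_word n w (inv_branch (w n) t).
Proof. by elim: n w => //= n IH w; rewrite -IH. Qed.

Lemma inv_word_itinerary n t :
  inv_word n (fun j => region (iter j (@pedal R) t)) (iter n (@pedal R) t) = t.
Proof.
elim: n => // n IH; rewrite inv_wordSr [iter n.+1 _ _]/=.
by rewrite region_pedalK.
Qed.

Definition word_pt n w := fixpt (ratio_word n w) (inv_word n w).

Lemma word_ptP n w : (0 < n)%N -> inv_word n w (word_pt n w) = word_pt n w.
Proof.
by move=> n0; apply: fixptP; [exact: inv_word_similarity|exact: ratio_word_lt1].
Qed.

Lemma word_pt_uniq n w t : (0 < n)%N -> inv_word n w t = t -> t = word_pt n w.
Proof.
by move=> n0; apply: fixed_uniq; [exact: inv_word_similarity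
                                 |exact: ratio_word_lt1].
Qed.

Lemma word_pt_inCbar n w : (0 < n)%N -> inCbar (word_pt n w).
Proof.
move=> n0; apply: fixpt_inCbar; first exact: inv_word_similarity.
  exact: ratio_word_lt1.
by move=> t; apply: inv_word_inCbar.
Qed.

(** The first inverse branch conjugates the rotated inverse word to the original one, so it carries
    fixed point to fixed point. *)
Lemma word_pt_shift n w :
  (0 < n)%N -> w n = w 0%N ->
  word_pt n w = inv_branch (w 0%N) (word_pt n (shift w)).
Proof.
move=> n0 wn; apply/esym/word_pt_uniq => //.
by rewrite -{1}wn -inv_wordSr /= word_ptP.
Qed.

(** * Cyclic orbits *)

Section CyclicOrbit.
Variables (n : nat) (w : nat -> letter) (v : nat -> R * R * R).
Hypotheses (n_gt0 : (0 < n)%N) (vn : forall j, v (j + n)%N = v j)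
  (vC : forall j, inCbar (v j))
  (vS : forall j, v j = inv_branch (w j) (v j.+1)).
Hypothesis w_mixed : exists j, (w j).1 != (w j).2.

Lemma cyclic_period k j : v (j + k * n)%N = v j.
Proof.
elim: k => [|k IH]; first by rewrite addn0.
by rewrite mulSn addnCA addnC vn.
Qed.

(** Forward invariance also reaches earlier indices, by going around the cycle. *)
Lemma cyclic_invariant (Q : R * R * R -> Prop) j :
  (forall i, Q (v i) -> Q (v i.+1)) -> Q (v j) -> forall i, Q (v i).
Proof.
move=> QS Qj i.
have Qk k : Q (v (j + k)%N) by elim: k => [|k]; rewrite ?addn0 ?addnS //; apply: QS.
have le_j : (j <= i + j * n)%N by rewrite (leq_trans _ (leq_addl _ _)) ?leq_pmulr.
by have := Qk (i + j * n - j)%N; rewrite subnKC // cyclic_period.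
Qed.

Lemma degenerateS j : v j = (1, 0, 0) -> w j = (false, false) /\ v j.+1 = (1, 0, 0).
Proof.
rewrite (vS j); have := vC j.+1; case: (v j.+1) => -[x y] z [? ? ? ?].
case: (w j) => -[] [] [? ? ?]; try by exfalso; lra.
by split => //; congr (_, _, _); lra.
Qed.

Lemma cyclic_not_degenerate j : v j <> (1, 0, 0).
Proof.
move=> vj; have [k] := w_mixed.
have all_deg := cyclic_invariant (Q := fun t => t = (1, 0, 0))
  (fun i vi => (degenerateS vi).2) vj.
by rewrite (degenerateS (all_deg k)).1.
Qed.

(** A zero third coordinate stays zero through R_1 and R_2, while R_0 and R_3 send it to the
    excluded point (1, 0, 0). *)
Lemma cyclic_c_gt0 j : 0 < (v j).2.
Proof.
have vj_ge0 i : 0 <= (v i).2 by have := vC i; case: (v i) => -[? ?] ? [].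
rewrite lt_neqAle vj_ge0 andbT eq_sym; apply/eqP => vj0.
have zeroS i : (v i).2 = 0 -> (v i.+1).2 = 0 /\ (w i).1 = (w i).2.
  have := @cyclic_not_degenerate i.+1; rewrite (vS i); have := vC i.+1.
  case: (v i.+1) => -[x y] z [? ? ? ?] ne.
  case: (w i) => -[] [] /= z0; try by split => //; lra.
    by case: ne; congr (_, _, _); lra.
  by case: ne; congr (_, _, _); lra.
have all0 := cyclic_invariant (Q := fun t => t.2 = 0)
  (fun i vi => (zeroS i vi).1) vj0.
by have [k /eqP[]] := w_mixed; exact: (zeroS k (all0 k)).2.
Qed.

(** The first coordinate of [v j] differs from 1/2 by half a coordinate of [v j.+1], all of which
    are positive. *)
Lemma cyclic_inCstar j : inCstar (v j).
Proof.
have := cyclic_c_gt0 j; have := vC j; rewrite (vS j).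
have := cyclic_c_gt0 j.+1; have := vC j.+1.
case: (v j.+1) => -[x y] z [? ? ? ?] /= ?.
by case: (w j) => -[] [] [? ? ? ?] /= ?; split; try (by split; lra);
  apply/eqP => ?; lra.
Qed.

Definition isosceles t := t.1.1 = t.1.2 \/ t.1.2 = t.2.
Definition equilateral t := t.1.1 = t.1.2 /\ t.1.2 = t.2.

Lemma isoscelesS j : isosceles (v j) -> isosceles (v j.+1).
Proof.
rewrite (vS j) /isosceles; have := cyclic_c_gt0 j.+1; have := vC j.+1.
case: (v j.+1) => -[x y] z [? ? ? ?] /= ?.
by case: (w j) => -[] [] /= [?|?]; solve [exfalso; lra|left; lra|right; lra].
Qed.

Lemma equilateralS j :
  equilateral (v j) -> equilateral (v j.+1) /\ w j = (false, true).
Proof.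
rewrite (vS j) /equilateral; have := cyclic_c_gt0 j.+1; have := vC j.+1.
case: (v j.+1) => -[x y] z [? ? ? ?] /= ?.
by case: (w j) => -[] [] /= [? ?]; try (by exfalso; lra); split=> //; split; lra.
Qed.

(* The closed regions of R_2 and R_3 contain points that [region] assigns to
   another branch: those with image x = y, resp. y = z. *)
Lemma cyclic_generic j :
  (w j).1 -> if (w j).2 then (v j.+1).1.2 < (v j.+1).1.1
             else (v j.+1).2 < (v j.+1).1.2.
Proof.
move=> wj.
(* A tie in [v j.+1] makes [v j] isosceles by cyclicity, which forces [v j.+1] to be equilateral;
   then every letter is that of R_0, against [wj]. *)
have all_iso : isosceles (v j.+1) -> isosceles (v j).
  by move=> isoS; apply: (cyclic_invariant isoscelesS isoS).
have not_equi : ~ equilateral (v j.+1).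
  move=> eqS; have := cyclic_invariant (fun i vi => (equilateralS vi).1) eqS j.
  by case/equilateralS => _ wj0; rewrite wj0 in wj.
move: all_iso not_equi wj; rewrite (vS j) /isosceles /equilateral.
have := cyclic_c_gt0 j.+1; have := vC j.+1.
case: (v j.+1) => -[x y] z [yx zy ? ?] /= ? iso ne.
case: (w j) iso => -[] [] //= iso _.
  rewrite lt_neqAle yx andbT; apply/eqP => yxE.
  by case: (iso (or_introl (esym yxE))) => ?; [lra|apply: ne; split; lra].
rewrite lt_neqAle zy andbT; apply/eqP => zyE.
by case: (iso (or_intror (esym zyE))) => ?; [lra|apply: ne; split; lra].
Qed.

Lemma cyclic_region j : region (v j) = w j.
Proof.
rewrite (vS j); have := @cyclic_generic j.
have := cyclic_c_gt0 j.+1; have := vC j.+1.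
by case: (v j.+1) => -[x y] z vCj z0 gen; apply: region_inv_branch.
Qed.

Lemma cyclic_pedal j : iter j (@pedal R) (v 0%N) = v j.
Proof.
elim: j => //= j ->; rewrite [X in pedal X]vS inv_branchK //.
by rewrite -vS cyclic_region.
Qed.

End CyclicOrbit.

Lemma word_pt_orbit n w j :
  (0 < n)%N -> (forall j, w (j + n)%N = w j) -> (exists j, (w j).1 != (w j).2) ->
  [/\ iter n (@pedal R) (word_pt n w) = word_pt n w,
      inCstar (iter j (@pedal R) (word_pt n w)) &
      region (iter j (@pedal R) (word_pt n w)) = w j].
Proof.
(* The candidate orbit consists of the fixed points of the successive rotations of [w]. *)
move=> n0 wn mix; pose v i := word_pt n (fun k => w (k + i)%N).
have vn i : v (i + n)%N = v i.
  by congr word_pt; apply/funext => k; rewrite addnA wn.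
have vC i : inCbar (v i) by exact: word_pt_inCbar.
have vS i : v i = inv_branch (w i) (v i.+1).
  rewrite {1}/v word_pt_shift ?add0n ?[(n + i)%N]addnC ?wn //.
  by congr (inv_branch _ (word_pt _ _)); apply/funext => k; rewrite /shift addSnnS.
have -> : word_pt n w = v 0%N.
  by congr word_pt; apply/funext => k; rewrite addn0.
have orb := cyclic_pedal n0 vn vC vS mix.
split; rewrite orb; first by rewrite -[n]add0n vn.
  exact: (cyclic_inCstar n0 vn vC vS mix).
exact: (cyclic_region n0 vn vC vS mix).
Qed.

Lemma pedal_double_c t : (region t).1 = (region t).2 -> (pedal t).2 = 2 * t.2.
Proof. by case: t => -[a b] c; rewrite /region /pedal; do 3?case: ifP. Qed.

(** Otherwise one period would multiply the positive third coordinate by 2^n > 1. *)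
Lemma periodic_mixed n t :
  (0 < n)%N -> 0 < t.2 -> iter n (@pedal R) t = t ->
  ~ (forall j, (region (iter j (@pedal R) t)).1 = (region (iter j (@pedal R) t)).2).
Proof.
move=> n0 t0 tn same.
have dbl j : (iter j (@pedal R) t).2 = 2 ^+ j * t.2.
  by elim: j => [|j IH]; rewrite ?mul1r // iterS pedal_double_c // IH exprS mulrA.
have := dbl n; rewrite tn -[LHS]mul1r => /(mulIf (lt0r_neq0 t0)) /eqP.
by rewrite lt_eqF // exprn_egt1 ?ltr1n -?lt0n.
Qed.

End Branches.

(** * Primitive words *)

Section Words.
Variable n' : nat.
Local Notation n := n'.+1.
Implicit Type W : word2 2 n.

Definition column W (j : nat) : letter :=
  (W (ord0, ord_mod n' j), W (ord_max, ord_mod n' j)).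

Definition word_of_columns (w : nat -> letter) : word2 2 n :=
  [ffun p : 'I_2 * 'I_n => if p.1 == ord0 then (w p.2).1 else (w p.2).2].

Lemma ord_modn (k j : nat) : ord_mod k (j %% k.+1) = ord_mod k j.
Proof. by apply: val_inj; rewrite /= modn_mod. Qed.

Lemma ord_mod_val (k : nat) (j : 'I_k.+1) : ord_mod k j = j.
Proof. by apply: val_inj; rewrite /= modn_small. Qed.

Lemma column_period W j : column W (j + n) = column W j.
Proof. by rewrite /column -(ord_modn _ (j + n)) modnDr ord_modn. Qed.

Lemma ord2E (i : 'I_2) : i = ord0 \/ i = ord_max.
Proof. by case: i => -[|[|//]] lti; [left|right]; apply: val_inj. Qed.

Lemma column_inj : injective column.
Proof.
move=> W W' eqW; apply/ffunP => -[i j].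
have := congr1 (fun f => f (val j)) eqW; rewrite /column !ord_mod_val => -[].
by case: (ord2E i) => ->.
Qed.

Lemma word_of_columnsK w :
  (forall j, w (j %% n)%N = w j) -> column (word_of_columns w) = w.
Proof.
by move=> wn; apply/funext => j; rewrite /column !ffunE /= wn -surjective_pairing.
Qed.

(** With two rows, [p >= 2] forces [V] to have a single row, and [q >= 2] makes its width a proper
    divisor of [n]. *)
Lemma periodicP W :
  periodic W <-> (forall j, (column W j).1 = (column W j).2) \/
    exists e, [/\ (0 < e < n)%N, (e %| n)%N &
                  forall j, column W (j + e)%N = column W j].
Proof.
split.
  case=> m1 [n1] [p] [q] [V] [pm qn pq WV]; case/orP: pq => [p2|q2].
    left=> j; rewrite /column /= !WV; congr (V (_, _)); apply: val_inj => /=.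
    by have -> : m1 = 0%N by nia.
  right; exists n1.+1; split; [by apply/andP; split; nia| |].
    by rewrite -qn dvdn_mull.
  have modE j : (j %% n %% n1.+1 = j %% n1.+1)%N.
    by rewrite modn_dvdm // -qn dvdn_mull.
  move=> j; rewrite /column !WV.
  congr (V (_, _), V (_, _)); by apply: val_inj; rewrite /= !modE modnDr.
case=> [same|[e [/andP[e0 en] /dvdnP[q qE] We]]].
  exists 0%N, n', 2, 1%N, [ffun p : 'I_1 * 'I_n => W (ord0, p.2)]; split; rewrite ?mul1n //.
  move=> i j; rewrite ffunE /= ord_mod_val; case: (ord2E i) => -> //.
  by have := same j; rewrite /column /= ord_mod_val.
case: e e0 en qE We => // e _ en qE We.
exists 1%N, e, 1%N, q, [ffun p : 'I_2 * 'I_e.+1 => W (p.1, ord_mod n' p.2)].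
split; rewrite ?mul1n //; first by apply/orP; right; nia.
move=> i j; rewrite ffunE /= ord_mod_val.
have Wk k l : column W (l + k * e.+1)%N = column W l.
  by elim: k => [|k IH]; rewrite ?addn0 // mulSn addnCA addnC We.
have := Wk (j %/ e.+1)%N (j %% e.+1)%N; rewrite addnC -divn_eq.
by rewrite /column ord_mod_val; case: (ord2E i) => -> [].
Qed.

End Words.

(** * Primitive words and points of exact period *)

Section Correspondence.
Variables (R : realType) (n' : nat).
Local Notation n := n'.+1.
Local Notation pedal := (@pedal R).

Lemma primitive_orbit (W : word2 2 n) j :
  primitive W ->
  let t := word_pt R n (column W) in
  [/\ iter n pedal t = t, inCstar (iter j pedal t) &
      region (iter j pedal t) = column W j].
Proof.
move=> prW; apply: word_pt_orbit => //; first exact: column_period.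
apply: contrapT => nmix; apply/prW/periodicP; left=> i.
by apply/eqP/negPn/negP => ne; apply: nmix; exists i.
Qed.

Lemma inT_word_pt (W : word2 2 n) : primitive W -> inT n (word_pt R n (column W)).
Proof.
move=> prW; have := primitive_orbit _ prW; move: (word_pt _ _ _) => t orb.
have [tn tC _] := orb 0%N; split=> //.
- by case: t tC {orb tn} => -[a b] c [].
- by move=> j _; have [] := orb j.
move=> d d1 dn td; apply/prW/periodicP; right.
(* An arbitrary return time [d < n] need not divide [n], as a word period must; the gcd is again a
   return time. *)
exists (gcdn d n); split; rewrite ?dvdn_gcdr //.
  by rewrite gcdn_gt0 d1 (leq_ltn_trans (dvdn_leq d1 (dvdn_gcdl _ _))).
move=> j; have [_ _ <-] := orb j; have [_ _ <-] := orb (j + gcdn d n)%N.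
by rewrite iterD (iter_gcdn_fixed d1 td tn).
Qed.

Lemma inT_is_word_pt (t : R * R * R) :
  inT n t -> exists2 W : word2 2 n, primitive W & t = word_pt R n (column W).
Proof.
case=> tC _ tn tmin; pose w j := region (iter j pedal t).
have wn j : w (j %% n)%N = w j by rewrite /w iter_modn.
have itin u : iter n pedal u = u ->
    u = word_pt R n (fun j => region (iter j pedal u)).
  by move=> un; apply: word_pt_uniq => //; rewrite -{2}un inv_word_itinerary.
exists (word_of_columns n' w); rewrite ?word_of_columnsK //; last exact: itin.
move/periodicP; rewrite word_of_columnsK // => -[].
  apply: (@periodic_mixed _ n) => //.
  by case: (t) tC => -[a b] c [].
case=> e [/andP[e0 en] _ we]; apply: (tmin e) => //.
(* [t] and its [e]-th iterate have the same itinerary, so they are the fixed point of the same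
   inverse word. *)
apply: etrans (itin _ _) _; first by rewrite -iterD addnC iterD tn.
rewrite [RHS]itin //.
by congr word_pt; apply/funext => j; rewrite -iterD -[RHS]we.
Qed.

Lemma word_pt_column_inj (W W' : word2 2 n) :
  primitive W -> primitive W' ->
  word_pt R n (column W) = word_pt R n (column W') -> W = W'.
Proof.
move=> prW prW' eqW; apply/column_inj/funext => j.
by have [_ _ <-] := primitive_orbit j prW; have [_ _ <-] := primitive_orbit j prW';
  rewrite eqW.
Qed.

End Correspondence.

(* chi(n) = |T_n| = psi_2(2,n): T_n is finite, enumerated without repetition
   by a list of length psi_2(2,n). *)
Theorem mainTheorem1 (R : realType) (n : nat) (hn : (1 <= n)%N) :
  exists s : seq (R * R * R),
    [/\ uniq s, (forall t, t \in s <-> inT n t) & size s = psi2 2 n].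
Proof.
case: n hn => // n' _.
exists [seq word_pt R n'.+1 (column W)
       | W <- enum [set W : word2 2 n'.+1 | `[< primitive W >]]].
split.
- rewrite map_inj_in_uniq ?enum_uniq // => W W'.
  rewrite !mem_enum !inE => /asboolP prW /asboolP prW'.
  exact: word_pt_column_inj.
- move=> t; split.
    by case/mapP => W; rewrite mem_enum inE => /asboolP /(inT_word_pt R) ? ->.
  case/inT_is_word_pt => W prW ->; apply: map_f.
  by rewrite mem_enum inE; apply/asboolP.
by rewrite size_map -cardE.
Qed.
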